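(* Two finite-dimensional complex representations $\phi$ and $\psi$ of $\mathfrak{sl}(2,\mathbb{C})$ are isomorphic if and only if they have the same characteristic polynomial, i.e. $f_\phi=f_\psi$ in $\mathbb{C}[z_0,z_1,z_2,z_3]$.
   Context: $\mathfrak{sl}(2,\mathbb{C})$ is the Lie algebra of traceless $2\times 2$ complex matrices with basis $h=\begin{pmatrix}1&0\\0&-1\end{pmatrix}$, $e_1=\begin{pmatrix}0&1\\0&0\end{pmatrix}$, $e_2=\begin{pmatrix}0&0\\1&0\end{pmatrix}$. For a finite-dimensional complex representation $\phi$ of $\mathfrak{sl}(2,\mathbb{C})$, its characteristic polynomial is $$f_{\phi}(z_0,z_1,z_2,z_3)=\det\left(z_0 I+z_1\phi(h)+z_2\phi(e_1)+z_3\phi(e_2)\right)\in\mathbb{C}[z_0,z_1,z_2,z_3].$$ *)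

(* Defs.v *)
From HB Require Import structures.
From mathcomp Require Import all_boot all_order all_algebra.
From mathcomp Require Import mpoly.

Set Implicit Arguments.
Unset Strict Implicit.
Unset Printing Implicit Defensive.

Import GRing.Theory passmx.
Local Open Scope ring_scope.

Definition traceless (F : fieldType) : {pred 'M[F]_2} :=
  [pred A | \tr A == 0].

Lemma traceless_submod_closed (F : fieldType) :
  submod_closed (@traceless F).
Proof.
split=> [|a A B]; rewrite !inE ?mxtrace0 //.
by move=> /eqP trA /eqP trB; rewrite mxtraceD mxtraceZ trA trB mulr0 addr0.
Qed.

HB.instance Definition _ (F : fieldType) :=
  GRing.isSubmodClosed.Build F 'M[F]_2 (@traceless F)
    (@traceless_submod_closed F).

Record sl2 (F : fieldType) :=
  Sl2 { mx_of_sl2 :> 'M[F]_2; _ : mx_of_sl2 \in @traceless F }.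

HB.instance Definition _ (F : fieldType) := [isSub for @mx_of_sl2 F].
HB.instance Definition _ (F : fieldType) := [Choice of sl2 F by <:].
HB.instance Definition _ (F : fieldType) :=
  [SubChoice_isSubLmodule of sl2 F by <:].

Lemma traceless_bracket (F : fieldType) (A B : 'M[F]_2) :
  A *m B - B *m A \in @traceless F.
Proof. by rewrite inE raddfB /= mxtrace_mulC subrr. Qed.

Definition sl2_bracket (F : fieldType) (x y : sl2 F) : sl2 F :=
  Sl2 (traceless_bracket x y).

Lemma traceless_h (F : fieldType) :
  delta_mx 0 0 - delta_mx 1 1 \in @traceless F.
Proof.
by rewrite inE /mxtrace !big_ord_recl big_ord0 !mxE subr0 sub0r addr0 subrr.
Qed.

Lemma traceless_e1 (F : fieldType) : delta_mx 0 1 \in @traceless F.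
Proof. by rewrite inE /mxtrace !big_ord_recl big_ord0 !mxE !addr0. Qed.

Lemma traceless_e2 (F : fieldType) : delta_mx 1 0 \in @traceless F.
Proof. by rewrite inE /mxtrace !big_ord_recl big_ord0 !mxE !addr0. Qed.

Definition sl2_h (F : fieldType) : sl2 F := Sl2 (@traceless_h F).
Definition sl2_e1 (F : fieldType) : sl2 F := Sl2 (@traceless_e1 F).
Definition sl2_e2 (F : fieldType) : sl2 F := Sl2 (@traceless_e2 F).

Record sl2_rep (F : fieldType) (V : vectType F) := Sl2Rep {
  sl2_rep_fun :> {linear sl2 F -> 'End(V)};
  sl2_rep_bracket : forall x y : sl2 F,
    sl2_rep_fun (sl2_bracket x y) =
      (sl2_rep_fun x \o sl2_rep_fun y)%VF - (sl2_rep_fun y \o sl2_rep_fun x)%VF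
}.

Definition sl2_rep_iso (F : fieldType) (V W : vectType F)
    (phi : sl2_rep V) (psi : sl2_rep W) : Prop :=
  exists2 T : 'Hom(V, W), bijective T &
    forall (x : sl2 F) (v : V), T (phi x v) = psi x (T v).

(* [mxof e e f] acts on row vectors, so it is the transpose of the usual matrix
   of [f] in the basis [e]; this does not change the determinant below.
   When [V] is zero-dimensional the polynomial is 1. *)
Definition sl2_char_poly_in (F : fieldType) (V : vectType F)
    (e : (\dim {:V}).-tuple V) (phi : sl2_rep V) : {mpoly F[4]} :=
  let mat x := map_mx (@mpolyC 4 F) (mxof e e (phi x)) in
  \det (('X_0)%:M + 'X_1 *: mat (sl2_h F)
        + 'X_2 *: mat (sl2_e1 F) + 'X_3 *: mat (sl2_e2 F)).

Definition sl2_char_poly (F : fieldType) (V : vectType F) (phi : sl2_rep V) :=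
  sl2_char_poly_in (vbasis {:V}) phi.

Lemma sl2_char_poly_basis (F : fieldType) (V : vectType F)
    (e : (\dim {:V}).-tuple V) (phi : sl2_rep V) :
  basis_of {:V} e -> sl2_char_poly_in e phi = sl2_char_poly phi.
Proof.
move=> eB; have bB := vbasisP {:V}; rewrite /sl2_char_poly /sl2_char_poly_in.
set b := vbasis _ in bB *.
set P := mxof e b \1; set Q := mxof b e \1.
have PQ : P *m Q = 1%:M by rewrite -mxof_comp // comp_lfun1l mxof1 // (basis_free eB).
have conj x : mxof e e (phi x) = P *m mxof b b (phi x) *m Q.
  by rewrite -!mxof_comp // comp_lfun1l comp_lfun1r.
set c := @mpolyC 4 F.
have cPQ : map_mx c P *m map_mx c Q = 1%:M by rewrite -map_mxM PQ map_mx1.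
rewrite !conj !map_mxM /=.
have X0_conj : ('X_0)%:M = map_mx c P *m ('X_0)%:M *m map_mx c Q :> 'M_(\dim {:V}).
  by rewrite scalar_mxC -mulmxA cPQ mulmx1.
have scale_conj (a : {mpoly F[4]}) M :
    a *: (map_mx c P *m M *m map_mx c Q) = map_mx c P *m (a *: M) *m map_mx c Q.
  by rewrite -scalemxAr -scalemxAl.
rewrite {1}X0_conj !scale_conj -!mulmxDl -!mulmxDr !det_mulmx.
by rewrite mulrAC -det_mulmx cPQ det1 mul1r.
Qed.

(* Main.v *)
From HB Require Import structures.
Require Import Defs.
From mathcomp Require Import all_boot all_order all_algebra.
From mathcomp Require Import mpoly zify.
From mathcomp Require Import reals complex.

Set Implicit Arguments.
Unset Strict Implicit.
Unset Printing Implicit Defensive.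

Import Order.TTheory GRing.Theory Num.Theory passmx.
Local Open Scope ring_scope.

(** An isomorphism carries a basis to a basis in which the same matrices
occur, so it preserves the characteristic polynomial. The converse says that a
finite-dimensional representation is determined by the multiset of eigenvalues
of [h], which is read off the characteristic polynomial at
[z_0 = X, z_1 = -1, z_2 = z_3 = 0].

Write [e, f] for the images of [e_1, e_2]. The powers of [f] are eigenvectors
of [ad h] for distinct eigenvalues, so [f] is nilpotent, and so is [e] by
symmetry ([nilpotent_f], [nilpotent_e]). The identity
[e^k f^k v = k! h (h - 1) ... (h - k + 1) v] on [ker e] ([iter_e_f]) then shows
that [h] is diagonalizable on [ker e] with natural eigenvalues
([hwv_basis_exists]). This choice of a basis of highest weight vectors replaces
a decomposition into irreducible representations.

Complete reducibility takes the form [V = ker e + im f]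
([lker_e_add_limg_f]). The two summands intersect trivially because [e f] is
injective on vectors of positive weight ([ef_inj_pos_wt],
[lker_e_cap_limg_f]); the same holds for [ker f] and [im e], and comparing
dimensions gives equality. Since [f] is nilpotent it follows that [V] is the
sum of the spaces [f^j (ker e)], so the vectors [f^j v_i], where the [v_i] form
an eigenbasis of [ker e] with weights [n_i] and [0 <= j <= n_i], span [V]; they
are free because [e] lowers [j] by a nonzero factor ([string_vec_span],
[string_vec_free]). In this basis the action of [e], [f] and [h] depends on the
[n_i] alone, so equal lists of highest weights give isomorphic representations
([hwv_basis_iso]).

The basis vector [f^j v_i] has weight [n_i - 2j]. A natural number [m] thus
occurs as a weight exactly as often as [m + 2], plus once for every [n_i] equal
to [m] ([count_string_wt_nat]), so the weights determine the [n_i]. *)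

(** * Linear algebra over a field *)

Section LinearAlgebra.
Variable F : fieldType.

(** The eigenvalues of [D] are roots of its characteristic polynomial, so only
finitely many of the [c k] can have a nonzero eigenvector. *)
Lemma finitely_many_eigenvalues (U : vectType F) (D : 'End(U)) (c : nat -> F)
    (u : nat -> U) :
  injective c -> (forall k, D (u k) = c k *: u k) -> exists k, u k = 0.
Proof.
move=> c_inj Du; set A := mxof (vbasis {:U}) (vbasis {:U}) D.
have bU := vbasisP {:U}.
case: (pickP (fun k : 'I_(\dim {:U}).+1 => u k == 0)) => [k /eqP|nz].
  by exists k.
have := @max_poly_roots _ (char_poly A) (mkseq c (\dim {:U}).+1).
rewrite size_char_poly size_mkseq ltnn => absurd.
suff: false by []; apply: absurd.
- by rewrite monic_neq0 // char_poly_monic.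
- apply/allP=> x /mapP[k]; rewrite mem_iota add0n => /andP[_ lt_k] ->.
  rewrite -eigenvalue_root_char; apply/eigenvalueP.
  exists (rVof (vbasis {:U}) (u k)).
    by rewrite -rVof_app // Du linearZ.
  by rewrite rVof_eq0 // (nz (Ordinal lt_k)).
- by rewrite mkseq_uniq.
Qed.

Lemma iter_lfun_is_linear (V : vectType F) (f : 'End(V)) k : linear (iter k f).
Proof. by elim: k => [|k IH] a u v //=; rewrite IH linearP. Qed.
HB.instance Definition _ (V : vectType F) (f : 'End(V)) k :=
  GRing.isLinear.Build F V V *:%R (iter k f) (iter_lfun_is_linear f k).

Lemma exists_free_map (T : eqType) (V : vectType F) (g : T -> V) (s : seq T) :
  exists t : seq T,
    [/\ {subset t <= s}, free (map g t) & <<map g t>>%VS = <<map g s>>%VS].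
Proof.
elim: s => [|x s [t [sts ft ets]]]; first by exists [::]; rewrite nil_free.
have [xt|xt] := boolP (g x \in <<map g t>>%VS).
  exists t; split=> // [y /sts|]; first by rewrite inE orbC => ->.
  by rewrite /= span_cons -ets; apply/esym/addv_idPr.
exists (x :: t); split; last by rewrite /= !span_cons ets.
  by move=> y; rewrite !inE => /predU1P[-> | /sts ->]; rewrite ?eqxx ?orbT.
by rewrite /= free_cons xt.
Qed.

Lemma free_codomP (V : vectType F) (I : finType) (b : I -> V) :
  (forall c : I -> F, \sum_i c i *: b i = 0 -> c =1 fun=> 0) -> free (codom b).
Proof.
move=> indep; apply/(@freeP _ _ _ (codom_tuple b)) => k sum0 i.
rewrite -(enum_valK i); apply: (indep (fun x => k (enum_rank x))).
rewrite (reindex (@enum_val I predT)) /=; last exact/onW_bij/enum_val_bij.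
rewrite -[RHS]sum0; apply: eq_bigr => j _.
by rewrite enum_valK (nth_image 0).
Qed.

Lemma linfun_of_free (V W : vectType F) (I : finType)
    (b : I -> V) (b' : I -> W) :
  free (codom b) -> exists T : 'Hom(V, W), forall i, T (b i) = b' i.
Proof.
move=> fb; have [T TE] := linear_of_free (codom b) (codom b').
have {}TE := TE fb; rewrite !size_codom in TE; have {}TE := TE erefl.
exists (linfun T) => i; rewrite lfunE /=.
have lt_i : (enum_rank i < size (codom b))%N by rewrite size_codom.
have := congr1 (nth 0 ^~ (enum_rank i)) TE; rewrite (nth_map 0) //.
by rewrite !(nth_image 0 _ (enum_rank i)) enum_rankK.
Qed.

End LinearAlgebra.

(** * Nilpotency and diagonalizability on the kernel of e *)

Section Sl2Triple.
Variables (F : numFieldType) (V : vectType F).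
Implicit Types (e f h : 'End(V)) (v w : V).

Definition sl2_triple e f h :=
  [/\ forall v, h (e v) = e (h v) + 2 *: e v,
      forall v, h (f v) = f (h v) - 2 *: f v
    & forall v, e (f v) = f (e v) + h v].

(** Because of this symmetry, statements about [ker e] and [im f] also hold for
[ker f] and [im e], with all weights negated. *)
Lemma sl2_triple_swap e f h : sl2_triple e f h -> sl2_triple f e (- h).
Proof.
case=> he hf ef; split=> v; rewrite !opp_lfunE.
- by rewrite hf linearN opprB addrC.
- by rewrite he linearN opprD.
- by rewrite ef addrK.
Qed.

Lemma h_iter_f e f h k v : sl2_triple e f h ->
  h (iter k f v) = iter k f (h v) - (2 * k)%:R *: iter k f v.
Proof.
case=> _ hf _; elim: k => [|k IH]; first by rewrite muln0 scale0r subr0.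
rewrite iterS hf IH linearB linearZ /= -addrA -opprD -scalerDl -natrD.
by congr (_ - _%:R *: _); rewrite mulnS addnC.
Qed.

Lemma e_iter_f e f h k v : sl2_triple e f h ->
  e (iter k.+1 f v) =
    iter k.+1 f (e v) + k.+1%:R *: iter k f (h v - k%:R *: v).
Proof.
move=> H; have [_ hf ef] := H.
elim: k => [|k IH]; first by rewrite /= scale0r subr0 scale1r ef.
rewrite iterS ef IH (h_iter_f _ _ H) linearD linearZ /= -addrA; congr (_ + _).
rewrite !linearB !linearZ /= -!iterS.
set x := iter k.+1 f _; set y := iter k.+1 f _.
rewrite !scalerA addrACA -[x in _ + x + _]scale1r -!scalerDl natr1.
by rewrite -!natrM -natrD; congr (_ + _%:R *: _); lia.
Qed.

(** If [e f w = 0] then the commutation relation for [f] and [e^(k+1)] gives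
[f e^(k+1) w = - (k+1) (m + 1 + k) e^k w], whose scalar is nonzero; so from
[e^(k+1) w = 0] one descends to [e^k w = 0], and finally to [w = 0]. *)
Lemma ef_inj_pos_wt e f h m w : sl2_triple e f h ->
  (exists k, iter k e w = 0) ->
  h w = m.+1%:R *: w -> e (f w) = 0 -> w = 0.
Proof.
move=> H [k]; elim: k => // k IH eSk hw efw.
apply: IH => //; have := e_iter_f k w (sl2_triple_swap H).
rewrite eSk linear0 opp_lfunE hw iterSr efw linear0 add0r.
rewrite -scaleNr -scalerBl linearZ /= scalerA => /esym/eqP.
rewrite scaler_eq0 => /orP[|/eqP//].
rewrite mulf_eq0 pnatr_eq0 /= -opprD oppr_eq0 -natrD pnatr_eq0 //.
Qed.

(** [f^k] is an eigenvector of [ad h] for the eigenvalue [- 2k], and [ad h] acts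
on the finite-dimensional space of endomorphisms. *)
Lemma nilpotent_f e f h : sl2_triple e f h -> exists k, forall v, iter k f v = 0.
Proof.
move=> H.
pose ad_h (g : 'End(V)) := (h \o g)%VF - (g \o h)%VF.
have ad_h_linear : linear ad_h.
  move=> a g1 g2; rewrite /ad_h comp_lfunDl comp_lfunDr -comp_lfunZl.
  by rewrite -comp_lfunZr scalerBr opprD addrACA.
pose ad_hL : {linear _ -> _} :=
  HB.pack ad_h (GRing.isLinear.Build _ _ _ _ ad_h ad_h_linear).
pose u k : 'End(V) := linfun (iter k f).
have [||k uk0] :=
    finitely_many_eigenvalues (D := linfun ad_hL) (c := fun k => - (2 * k)%:R) (u := u).
- by move=> i j /oppr_inj/eqP; rewrite eqr_nat eqn_pmul2l // => /eqP.
- move=> k; rewrite (lfunE ad_hL); apply/lfunP=> v.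
  rewrite /= /ad_h add_lfunE opp_lfunE !comp_lfunE scale_lfunE /u.
  by rewrite !(lfunE (iter k f)) /= (h_iter_f _ _ H) addrAC subrr add0r scaleNr.
exists k => v; have := congr1 (fun g : 'End(V) => g v) uk0.
by rewrite /u zero_lfunE lfunE.
Qed.

Lemma nilpotent_e e f h : sl2_triple e f h -> exists k, forall v, iter k e v = 0.
Proof. by move/sl2_triple_swap/nilpotent_f. Qed.

Definition h_prod h (cs : seq nat) v :=
  foldr (fun (c : nat) w => h w - c%:R *: w) v cs.

Lemma h_prod_stable h cs (U : {vspace V}) v : {in U, forall w, h w \in U} ->
  v \in U -> h_prod h cs v \in U.
Proof. by move=> hU vU; elim: cs => //= c cs IH; rewrite rpredB ?hU ?rpredZ. Qed.

Lemma h_prod_eigen h cs v a : h v = a *: v ->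
  h_prod h cs v = (\prod_(c <- cs) (a - c%:R)) *: v.
Proof.
move=> hv; elim: cs => [|c cs IH]; first by rewrite big_nil scale1r.
by rewrite /= IH big_cons linearZ /= hv !scalerA -scalerBl [_ * a]mulrC -mulrBl.
Qed.

Lemma h_prod_linear h cs : linear (h_prod h cs).
Proof.
elim: cs => [|c cs IH] a u v //=; rewrite IH linearP scalerDr opprD.
by rewrite scalerA mulrC -scalerA addrACA -scalerBr.
Qed.

Lemma lker_e_stable e f h : sl2_triple e f h ->
  {in lker e, forall v, h v \in lker e}.
Proof.
case=> he _ _ v; rewrite !memv_ker => /eqP ev.
by have := he v; rewrite ev linear0 scaler0 addr0 => <-.
Qed.

Lemma iter_e_f e f h k v : sl2_triple e f h -> e v = 0 ->
  iter k e (iter k f v) = k`!%:R *: h_prod h (iota 0 k) v.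
Proof.
move=> H; elim: k v => [|k IH] v ev; first by rewrite scale1r.
have vK : v \in lker e by rewrite memv_ker ev.
have -> : iota 0 k.+1 = iota 0 k ++ [:: k] by rewrite -addn1 iotaD.
rewrite iterSr (e_iter_f _ _ H) ev linear0 add0r linearZ_LR [LHS]/= IH.
  by rewrite scalerA -natrM -factS /h_prod foldr_cat.
by apply/eqP; rewrite -memv_ker rpredB ?rpredZ ?(lker_e_stable H).
Qed.

(** A polynomial with simple natural roots annihilates [h] on [ker e]: take
[k] in [iter_e_f] so large that [f^k = 0]. *)
Lemma h_prod_lker_e e f h : sl2_triple e f h ->
  exists N, {in lker e, forall v, h_prod h (iota 0 N) v = 0}.
Proof.
move=> H; have [N fN0] := nilpotent_f H; exists N => v; rewrite memv_ker => /eqP ev.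
have /esym/eqP := iter_e_f N H ev; rewrite fN0 linear0 scaler_eq0 pnatr_eq0.
by rewrite -leqn0 leqNgt fact_gt0 => /eqP.
Qed.

(** A nonzero [h]-stable subspace of [ker e] contains an eigenvector with natural
eigenvalue, since a product of factors [h - c] with [c] natural kills it. *)
Lemma hwv_stable0 e f h (U : {vspace V}) : sl2_triple e f h ->
  (U <= lker e)%VS -> {in U, forall v, h v \in U} ->
  (forall (n : nat) v, v \in U -> h v = n%:R *: v -> v = 0) -> U = 0%VS.
Proof.
move=> H /subvP sUe hU noeig; have [N hN] := h_prod_lker_e H.
apply/eqP; rewrite -subv0; apply/subvP=> v vU; rewrite memv0; apply/eqP.
have := hN v (sUe v vU); elim: (iota 0 N) => //= c cs IH /subr0_eq.
by move/noeig=> /(_ (h_prod_stable cs hU vU)).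
Qed.

Lemma hwv_wt_nat e f h v a : sl2_triple e f h -> e v = 0 -> h v = a *: v ->
  (forall n : nat, a != n%:R) -> v = 0.
Proof.
move=> H ev hv a_notnat; apply/eqP; rewrite -memv0.
suff <- : <[v]>%VS = 0%VS by exact: memv_line.
have hk k : h (k *: v) = (k * a) *: v by rewrite linearZ /= hv scalerA.
apply: (hwv_stable0 H).
- by rewrite -memvE memv_ker ev.
- by move=> _ /vlineP[k ->]; rewrite hk rpredZ ?memv_line.
move=> n _ /vlineP[k ->]; rewrite hk scalerA => /eqP.
rewrite -subr_eq0 -scalerBl scaler_eq0 [k * a]mulrC -mulrBl mulf_eq0.
rewrite subr_eq0 (negPf (a_notnat n)) /= => /predU1P[->|/eqP->].
  by rewrite scale0r.
by rewrite scaler0.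
Qed.

Definition hwv e h (p : nat * V) := (e p.2 = 0) /\ (h p.2 = p.1%:R *: p.2).

(** Induction on the list of roots [c] of the annihilating product: the vector
[w] obtained by applying all the factors but [h - c] has weight [c], and a
multiple of [w] can be subtracted from [v] to make the remaining product kill
the difference, because the roots are distinct. *)
Lemma lker_e_hwv_span e f h v : sl2_triple e f h -> e v = 0 ->
  exists s : seq (nat * V), (forall p, p \in s -> hwv e h p) /\
    v \in <<map snd s>>%VS.
Proof.
move=> H ev; have [N hN] := h_prod_lker_e H.
have := hN v; rewrite memv_ker ev => /(_ (eqxx _)).
elim: (iota 0 N) (iota_uniq 0 N) v ev {hN} => [|c cs IH] /=.
  by move=> _ v _ ->; exists [::]; split=> //; rewrite mem0v.
case/andP=> c_cs cs_uniq v ev; set w := h_prod h cs v => /subr0_eq hw.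
have ew : e w = 0.
  apply/eqP; rewrite -memv_ker h_prod_stable // ?memv_ker ?ev //.
  exact: (lker_e_stable H).
pose a : F := \prod_(d <- cs) (c%:R - d%:R).
have a_neq0 : a != 0.
  rewrite prodf_seq_neq0; apply/allP=> d d_cs /=; rewrite subr_eq0 eqr_nat.
  by apply: contraNneq c_cs => ->.
have [||s [s_hwv vs]] := IH cs_uniq (v - a^-1 *: w).
- by rewrite linearB linearZ /= ev ew scaler0 subr0.
- rewrite -scaleNr addrC h_prod_linear (h_prod_eigen _ hw) -/a -/w.
  by rewrite scalerA mulNr mulVf // scaleN1r addNr.
exists ((c, w) :: s); split=> [p|]; first by rewrite inE => /predU1P[->|/s_hwv].
by rewrite -[v](subrK (a^-1 *: w)) addrC span_cons memv_add // rpredZ ?memv_line.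
Qed.

(** * The splitting of V as the sum of ker e and im f *)

(** By [hwv_stable0] it suffices to treat [v = f w] with [e v = 0] of weight [n].
If [w] could be taken of weight [n + 2], then [ef_inj_pos_wt] would give
[w = 0]. A priori [h - (n + 2)] only maps [w] into [ker f]; but it is bijective
on [ker f], all weights there being nonpositive, so subtracting an element of
[ker f] from [w] gives it the right weight. *)
Lemma lker_e_cap_limg_f e f h : sl2_triple e f h -> (lker e :&: limg f = 0)%VS.
Proof.
move=> H; have [he hf ef] := H; apply: (hwv_stable0 H); first exact: capvSl.
  move=> v; rewrite !memv_cap => /andP[vK /memv_imgP[w _ vE]].
  by rewrite (lker_e_stable H) // vE hf -linearZ -linearB memv_img ?memvf.
move=> n v; rewrite memv_cap memv_ker => /andP[/eqP ev /memv_imgP[w _ vE]] hv.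
pose g := h - n.+2%:R *: \1%VF.
have gE u : g u = h u - n.+2%:R *: u.
  by rewrite add_lfunE opp_lfunE scale_lfunE id_lfunE.
have g_inj : (lker f :&: lker g = 0)%VS.
  apply/eqP; rewrite -subv0; apply/subvP=> u; rewrite memv_cap !memv_ker gE.
  rewrite memv0 subr_eq0 => /andP[/eqP fu /eqP hu]; apply/eqP.
  apply: (hwv_wt_nat (a := - n.+2%:R) (sl2_triple_swap H)) => // [|m].
    by rewrite opp_lfunE hu scaleNr.
  by rewrite eqr_oppLR -subr_eq0 opprK -natrD pnatr_eq0.
have g_im : (g @: lker f)%VS = lker f.
  apply/eqP; rewrite eqEdim limg_dim_eq // leqnn andbT.
  apply/subvP=> _ /memv_imgP[u uK ->]; rewrite gE.
  have hs := lker_e_stable (sl2_triple_swap H) uK.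
  by rewrite rpredB ?rpredZ // -memvN -opp_lfunE.
have : g w \in lker f.
  rewrite memv_ker gE linearB linearZ /= -vE -[f (h w)](subrK (2 *: f w)).
  by rewrite -hf -vE hv -scalerDl -scalerBl -natrD addn2 subrr scale0r.
rewrite -{1}g_im => /memv_imgP[u]; rewrite memv_ker => /eqP fu guw.
suff wu0 : w - u = 0 by rewrite vE -[w](subrK u) wu0 add0r fu.
apply: (ef_inj_pos_wt (m := n.+1) H).
- by have [k ek] := nilpotent_e H; exists k.
- apply: subr0_eq; rewrite -gE linearB /= guw subrr //.
- by rewrite linearB /= fu subr0 -vE.
Qed.

(** Both [ker e] with [im f] and [ker f] with [im e] have trivial intersection;
the dimensions of the four spaces add up to twice that of [V], so neither sum
can be a proper subspace. *)
Lemma lker_e_add_limg_f e f h : sl2_triple e f h ->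
  (lker e + limg f = fullv)%VS.
Proof.
move=> H; apply/eqP; rewrite eqEdim subvf /=.
have := dimv_disjoint_sum (lker_e_cap_limg_f H).
have := dimv_disjoint_sum (lker_e_cap_limg_f (sl2_triple_swap H)).
have := dimvS (subvf (lker f + limg e)).
have := dimvS (subvf (lker e + limg f)).
have := limg_ker_dim e fullv; have := limg_ker_dim f fullv.
by rewrite !capfv; lia.
Qed.

(** * Bases made of strings *)

Lemma e_iter_f_hwv e f h n v j : sl2_triple e f h -> e v = 0 ->
  h v = n%:R *: v ->
  e (iter j.+1 f v) = (j.+1%:R * (n%:R - j%:R)) *: iter j f v.
Proof.
move=> H ev hv; rewrite (e_iter_f _ _ H) ev linear0 add0r hv -scalerBl.
by rewrite linearZ /= scalerA.
Qed.

Lemma h_iter_f_hwv e f h n v j : sl2_triple e f h -> h v = n%:R *: v ->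
  h (iter j f v) = (n%:R - (2 * j)%:R) *: iter j f v.
Proof. by move=> H hv; rewrite (h_iter_f _ _ H) hv linearZ /= scalerBl. Qed.

(** [e] kills [f^(n+1) v] since the factor [n - n] appears, but its weight
[- n - 2] is not natural. *)
Lemma iter_f_hwv_end e f h n v : sl2_triple e f h -> e v = 0 ->
  h v = n%:R *: v -> iter n.+1 f v = 0.
Proof.
move=> H ev hv.
apply: (hwv_wt_nat H _ (h_iter_f_hwv n.+1 H hv)) => [|m].
  by rewrite (e_iter_f_hwv _ H ev hv) subrr mulr0 scale0r.
rewrite -subr_eq0 -addrA -opprD -natrD subr_eq0 eqr_nat; lia.
Qed.

(** The weights are kept in a list of their own: two representations with the
same list [ns] then have string bases indexed by the same finite type. *)
Definition hwv_basis e h (ns : seq nat) (vs : seq V) :=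
  [/\ size vs = size ns, basis_of (lker e) vs
    & forall i, h vs`_i = (nth 0%N ns i)%:R *: vs`_i].

Lemma hwv_basis_exists e f h : sl2_triple e f h ->
  exists ns vs, hwv_basis e h ns vs.
Proof.
move=> H.
have hwv_span X : {subset X <= lker e} -> exists s : seq (nat * V),
    (forall p, p \in s -> hwv e h p) /\ (<<X>> <= <<map snd s>>)%VS.
  elim: X => [|v X IH] XK; first by exists [::]; rewrite span_nil sub0v.
  have [s [s_hwv sX]] := IH (fun x xX => XK x (mem_behead (s := v :: X) xX)).
  have /eqP ev : e v == 0 by rewrite -memv_ker XK ?mem_head.
  have [t [t_hwv vt]] := lker_e_hwv_span H ev; exists (t ++ s); split=> [p|].
    by rewrite mem_cat => /orP[/t_hwv|/s_hwv].
  by rewrite map_cat span_cat span_cons addvS // -memvE.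
have [s [s_hwv]] := hwv_span _ (fun v => @vbasis_mem _ _ v (lker e)).
rewrite (span_basis (vbasisP _)) => sK.
have [t [sts ft et]] := exists_free_map snd s.
exists (map fst t), (map snd t); split; first by rewrite !size_map.
  rewrite /basis_of ft andbT eqEsubv et sK andbT -et.
  by apply/span_subvP=> _ /mapP[p /sts/s_hwv[ep _] ->]; rewrite memv_ker ep.
move=> i; have [lt_it|le_ti] := ltnP i (size t); last first.
  by rewrite !nth_default ?size_map // linear0 scaler0.
rewrite !(nth_map (0%N, 0)) //.
by have [] := s_hwv _ (sts _ (mem_nth (0%N, 0) lt_it)).
Qed.

(** The index [(i, j)] stands for the vector [f^j v_i], where [j <= n_i]. *)
Definition string_index (ns : seq nat) : finType :=
  {i : 'I_(size ns) & 'I_(nth 0%N ns i).+1}.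

Definition string_vec f (vs : seq V) ns (p : string_index ns) : V :=
  iter (tagged p) f vs`_(tag p).

Lemma hwv_basis_lker e h ns vs i : hwv_basis e h ns vs -> e vs`_i = 0.
Proof.
case=> _ vsK _; apply/eqP; rewrite -memv_ker.
have [lt_i|le_i] := ltnP i (size vs); last by rewrite nth_default ?mem0v.
by rewrite (basis_mem vsK) ?mem_nth.
Qed.

(** The span contains [f^j (ker e)] for all [j], because a string stops at
[j = n_i]. As [V = ker e + im f], it contains [im f^k] as soon as it contains
[im f^(k+1)]; start from [f^N = 0] and descend to [k = 0]. *)
Lemma string_vec_span e f h ns vs : sl2_triple e f h -> hwv_basis e h ns vs ->
  <<codom (string_vec f vs (ns := ns))>>%VS = fullv.
Proof.
move=> H B; have [sz_vs vsK hvs] := B; set U := span _.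
have vsU i j : (i < size vs)%N -> iter j f vs`_i \in U.
  rewrite sz_vs => lt_i; have [le_j|lt_j] := leqP j (nth 0%N ns i).
    apply: memv_span; apply/codomP.
    by exists (Tagged (fun i : 'I_(size ns) => 'I_(nth 0%N ns i).+1)
                 (i := Ordinal lt_i) (Ordinal (le_j : j < (nth 0%N ns i).+1)%N)).
  rewrite -(subnK lt_j) iterD.
  by rewrite (iter_f_hwv_end H (hwv_basis_lker i B) (hvs i)) linear0 mem0v.
have KU j v : v \in lker e -> iter j f v \in U.
  rewrite -(span_basis vsK) -[vs]in_tupleE => /coord_span->.
  rewrite linear_sum; apply: memv_suml => i _ /=.
  by rewrite linearZ rpredZ ?vsU.
have [N fN] := nilpotent_f H; apply/eqP; rewrite eqEsubv subvf; apply/subvP.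
suff down k : (k <= N)%N -> forall v, iter (N - k) f v \in U.
  by move=> v _; have := down N (leqnn N) v; rewrite subnn.
elim: k => [|k IH] le_kN v; first by rewrite subn0 fN mem0v.
have : v \in (lker e + limg f)%VS by rewrite (lker_e_add_limg_f H) memvf.
case/memv_addP=> a aK [_ /memv_imgP[w _ ->] ->].
have := IH (ltnW le_kN) w; rewrite -(subnSK le_kN) iterSr => fwU.
by rewrite linearD; apply: rpredD; [apply: KU | apply: fwU].
Qed.

(** Applying [e] to a linear relation shifts it down along the strings, with
nonzero factors [(j + 1) (n_i - j)] on the coefficients. By induction on a bound
for the [j] that occur, all coefficients with [0 < j] vanish, which leaves a
relation between the [v_i]. *)
Lemma string_vec_free e f h ns vs : sl2_triple e f h -> hwv_basis e h ns vs ->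
  free (codom (string_vec f vs (ns := ns))).
Proof.
move=> H B; have [sz_vs vsK hvs] := B.
pose n (i : 'I_(size ns)) := nth 0%N ns i.
have indep k (C : 'I_(size ns) -> nat -> F) :
    (forall (i : 'I_(size ns)) j, (k <= j <= n i)%N -> C i j = 0) ->
    \sum_i \sum_(j < (n i).+1) C i j *: iter j f vs`_i = 0 ->
    forall (i : 'I_(size ns)) j, (j <= n i)%N -> C i j = 0.
  elim: k C => [|k IH] C C0 sum0; first by move=> i j le_j; rewrite C0.
  (* the coefficients of the image under e, zero at j = n i *)
  pose C' i (j : nat) := C i j.+1 * (j.+1%:R * ((n i)%:R - j%:R)).
  have C'0 : forall (i : 'I_(size ns)) j, (j <= n i)%N -> C' i j = 0.
    apply: IH => [i j /andP[le_kj]|].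
      rewrite /C' leq_eqVlt => /predU1P[->|lt_jn]; first by rewrite subrr !mulr0.
      by rewrite C0 ?mul0r // ltnS le_kj.
    rewrite -[RHS](linear0 e) -[X in _ = _ X]sum0 [RHS]linear_sum.
    apply: eq_bigr => i _; rewrite linear_sum [RHS]big_ord_recl /=.
    rewrite linearZ /= (hwv_basis_lker i B) scaler0 add0r.
    rewrite big_ord_recr /= /C' subrr !mulr0 scale0r addr0.
    apply: eq_bigr => j _; rewrite linearZ /=.
    have eE := e_iter_f_hwv j H (hwv_basis_lker i B) (hvs i).
    by rewrite -iterS eE scalerA.
  have Cpos i j : (j < n i)%N -> C i j.+1 = 0.
    move=> lt_j; have /eqP := C'0 i j (ltnW lt_j).
    rewrite /C' !mulf_eq0 pnatr_eq0 subr_eq0 eqr_nat /=.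
    by rewrite [n i == j]gtn_eqF // orbF => /eqP.
  move=> i [|j] le_j; last exact: Cpos.
  move: i {le_j}; suff: forall i : 'I_(size vs), C (cast_ord sz_vs i) 0%N = 0.
    by move=> C0' i; rewrite -[ i ](cast_ordKV sz_vs) C0'.
  apply/(@freeP _ _ _ (in_tuple vs)); first exact: basis_free vsK.
  rewrite -[RHS]sum0 (reindex (cast_ord sz_vs)) /=; last first.
    by exists (cast_ord (esym sz_vs)) => ? _; rewrite ?cast_ordK ?cast_ordKV.
  apply: eq_bigr => i _; rewrite big_ord_recl big1 ?addr0 // => j _.
  by rewrite Cpos ?scale0r.
apply: free_codomP => c sum0 [i j] /=.
(* extended by zero so that the coefficients can be shifted in j *)
pose C i j := oapp (fun j : 'I_(n i).+1 => c (Tagged _ j)) 0 (insub j).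
have CE i' (j' : 'I_(n i').+1) : C i' j' = c (Tagged _ j') by rewrite /C valK.
have := indep (\max_(i < size ns) n i).+1 C; rewrite -CE; apply.
- move=> i' j' /andP[lt_j le_j].
  by have := leq_trans lt_j (leq_trans le_j (leq_bigmax i')); rewrite ltnn.
- rewrite -[RHS]sum0 sig_big_dep /=; apply: eq_bigr => -[i' j'] _ /=.
  by rewrite CE.
by rewrite -ltnS.
Qed.

Lemma hwv_basis_perm e h ns ns' vs : hwv_basis e h ns vs -> perm_eq ns' ns ->
  exists vs', hwv_basis e h ns' vs'.
Proof.
case=> sz_vs vsK hvs /(perm_iotaP 0%N)[Is pIs ->].
exists (map (nth 0 vs) Is); split; first by rewrite !size_map.
  rewrite (perm_basis _ (_ : perm_eq _ vs)) //; apply/(perm_iotaP 0).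
  by exists Is; rewrite ?sz_vs.
move=> i; have [lt_i|le_i] := ltnP i (size Is).
  by rewrite !(nth_map 0%N).
by rewrite !nth_default ?size_map // linear0 scaler0.
Qed.

End Sl2Triple.

(** The isomorphism maps [f^j v_i] to [f'^j w_i]. It commutes with [f] also at
the end of a string, where both images vanish. *)
Lemma hwv_basis_iso (F : numFieldType) (V W : vectType F) (e f h : 'End(V))
    (e' f' h' : 'End(W)) ns vs ws :
  sl2_triple e f h -> sl2_triple e' f' h' ->
  hwv_basis e h ns vs -> hwv_basis e' h' ns ws ->
  exists T : 'Hom(V, W), [/\ bijective T,
    (T \o e = e' \o T)%VF, (T \o f = f' \o T)%VF & (T \o h = h' \o T)%VF].
Proof.
move=> H H' B B'; set b := string_vec f vs (ns := ns).
set b' := string_vec f' ws (ns := ns).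
have spb : <<codom b>>%VS = fullv by exact: string_vec_span H B.
have spb' : <<codom b'>>%VS = fullv by exact: string_vec_span H' B'.
have [T Tb] := linfun_of_free b' (string_vec_free H B).
have [T' Tb'] := linfun_of_free b (string_vec_free H' B').
have [_ _ hvs] := B; have [_ _ hws] := B'.
have intertwine (x : 'End(V)) (x' : 'End(W)) :
    (forall p, T (x (b p)) = x' (b' p)) -> (T \o x = x' \o T)%VF.
  move=> Tx; apply/(fullv_lfunP _ _ spb) => _ /codomP[p ->].
  by rewrite !comp_lfunE Tx Tb.
have Ts i j : (i < size ns)%N -> (j <= nth 0%N ns i)%N ->
    T (iter j f vs`_i) = iter j f' ws`_i.
  move=> lt_i le_j.
  exact: (Tb (Tagged (fun i : 'I_(size ns) => 'I_(nth 0%N ns i).+1)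
    (i := Ordinal lt_i) (Ordinal (le_j : j < (nth 0%N ns i).+1)%N))).
exists T; split.
- exists T' => v.
    rewrite -comp_lfunE -[RHS]id_lfunE; apply/lfunP: v.
    apply/(fullv_lfunP _ _ spb) => _ /codomP[p ->].
    by rewrite comp_lfunE Tb Tb' id_lfunE.
  rewrite -comp_lfunE -[RHS]id_lfunE; apply/lfunP: v.
  apply/(fullv_lfunP _ _ spb') => _ /codomP[p ->].
  by rewrite comp_lfunE Tb' Tb id_lfunE.
- apply: intertwine => -[i [[|j] lt_j]]; rewrite /b /b' /string_vec /=.
    by rewrite (hwv_basis_lker i B) (hwv_basis_lker i B') linear0.
  have hw := e_iter_f_hwv j H (hwv_basis_lker i B) (hvs i).
  have hw' := e_iter_f_hwv j H' (hwv_basis_lker i B') (hws i).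
  by rewrite -!iterS hw hw' linearZ /= Ts // ltnW.
- apply: intertwine => -[i [j]]; rewrite /b /b' /string_vec /= ltnS leq_eqVlt.
  case/predU1P=> [->|lt_j]; last by rewrite -!iterS Ts.
  rewrite -!iterS (iter_f_hwv_end H (hwv_basis_lker i B) (hvs i)).
  by rewrite (iter_f_hwv_end H' (hwv_basis_lker i B') (hws i)) linear0.
apply: intertwine => -[i [j lt_j]]; rewrite /b /b' /string_vec /=.
by rewrite (h_iter_f_hwv _ H (hvs i)) (h_iter_f_hwv _ H' (hws i)) linearZ /= Ts.
Qed.

(** * The weights determine the highest weights *)

Definition string_wt (F : numFieldType) ns (p : string_index ns) : F :=
  (nth 0%N ns (tag p))%:R - (2 * tagged p)%:R.

Lemma count_string_wt (F : numFieldType) ns (a : F) :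
  count_mem a (codom (string_wt F (ns := ns))) =
    (\sum_(n <- ns) \sum_(j < n.+1) (n%:R - (2 * j)%:R == a)%R)%N.
Proof.
rewrite (big_nth 0%N) big_mkord sig_big_dep /= -sum1_count big_image_cond.
by rewrite big_mkcondr /=; apply: eq_big => // p _; case: eqP.
Qed.

(** The string [n, n - 2, ..., - n] without its first entry is the string shifted
down by 2 without its last entry, and the latter is [- n - 2], never natural. *)
Lemma count_string_wt_nat (F : numFieldType) ns (m : nat) :
  count_mem (m%:R : F) (codom (string_wt F (ns := ns))) =
    (count_mem m ns + count_mem (m.+2%:R : F) (codom (string_wt F (ns := ns))))%N.
Proof.
rewrite !count_string_wt -sum1_count [X in (X + _)%N]big_mkcond -big_split /=.
apply: eq_bigr => n _; rewrite big_ord_recl [in RHS]big_ord_recr /=.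
rewrite muln0 subr0 eqr_nat; congr (_ + _)%N.
rewrite [X in (_ + X)%N](_ : _ = 0%N) ?addn0.
  apply: eq_bigr => j _; congr nat_of_bool.
  by rewrite /bump !subr_eq -!natrD !eqr_nat; lia.
by rewrite subr_eq -natrD eqr_nat; apply/eqP; rewrite eqb0; lia.
Qed.

Lemma string_wt_inj (F : numFieldType) ns ns' :
  perm_eq (codom (string_wt F (ns := ns))) (codom (string_wt F (ns := ns'))) ->
  perm_eq ns ns'.
Proof.
move=> /permP eq_count; apply/allP=> m _ /=.
have := count_string_wt_nat F ns m; rewrite !eq_count count_string_wt_nat.
by move/addIn->.
Qed.

(** * Characteristic polynomials of representations *)

Section Representation.
Variables (F : fieldType).

Lemma sl2_bracket_h_e1 : sl2_bracket (sl2_h F) (sl2_e1 F) = 2 *: sl2_e1 F.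
Proof.
apply: val_inj; rewrite [RHS]linearZ /=.
rewrite mulmxBl mulmxBr !mul_delta_mx_cond /= mulr0n mulr1n subr0 sub0r opprK.
by rewrite scaler_nat.
Qed.

Lemma sl2_bracket_h_e2 : sl2_bracket (sl2_h F) (sl2_e2 F) = - (2 *: sl2_e2 F).
Proof.
apply: val_inj; rewrite [RHS]linearN [in RHS]linearZ /=.
rewrite mulmxBl mulmxBr !mul_delta_mx_cond /= mulr0n mulr1n subr0 sub0r.
by rewrite scaler_nat mulr2n.
Qed.

Lemma sl2_bracket_e1_e2 : sl2_bracket (sl2_e1 F) (sl2_e2 F) = sl2_h F.
Proof. by apply: val_inj; rewrite /= !mul_delta_mx_cond. Qed.

Lemma sl2_span (x : sl2 F) : exists a b c,
  x = a *: sl2_h F + b *: sl2_e1 F + c *: sl2_e2 F.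
Proof.
case: x => A trA; exists (A 0 0), (A 0 1), (A 1 0); apply: val_inj.
have A11 : A 1 1 = - A 0 0.
  apply/eqP; rewrite -addr_eq0 addrC; move: trA; rewrite inE /mxtrace.
  rewrite !big_ord_recl big_ord0 addr0.
  by rewrite (_ : lift ord0 ord0 = 1) //; apply: val_inj.
rewrite !linearD !linearZ; apply/matrixP=> i j; rewrite !mxE /=.
have ord2 (k : 'I_2) : k = 0 \/ k = 1.
  by case: k => [[|[|//]] lt_k]; [left | right]; apply: val_inj.
by have [-> | ->] := ord2 i; have [-> | ->] := ord2 j;
   rewrite /= ?A11 ?subr0 ?sub0r ?mulr1 ?mulr0 ?mulrN1 ?addr0 ?add0r ?subrr ?mulr0.
Qed.

(** This is [mxof] with a length [n] that is not syntactically a dimension, so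
that a basis of [V] can be moved to [W] without a cast. *)
Definition coord_mx (V : vectType F) n (e : n.-tuple V) (g : 'End(V)) : 'M_n :=
  \matrix_(i, j) coord e j (g e`_i).

Lemma mxof_coord (V : vectType F) (e : (\dim {:V}).-tuple V) g :
  mxof e e g = coord_mx e g.
Proof. by apply/matrixP=> i j; rewrite !mxE /= vecof_delta. Qed.

Lemma coord_map_basis (V W : vectType F) n (e : n.-tuple V) (T : 'Hom(V, W))
    j v :
  basis_of {:V} e -> lker T == 0%VS ->
  coord (map_tuple T e) j (T v) = coord e j v.
Proof.
move=> eB Tinj; have [spe fe] := andP eB.
have fTe : free (map_tuple T e).
  rewrite /free -limg_span (eqP spe) limg_dim_eq ?(eqP Tinj) ?capv0 //.
  by rewrite size_map -(eqP spe).
rewrite {1}(coord_basis eB (memvf v)) linear_sum.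
rewrite (eq_bigr (fun i => coord e i v *: (map_tuple T e)`_i)) => [|i _].
  by rewrite coord_sum_free.
by rewrite linearZ /= (nth_map 0) ?size_tuple.
Qed.

Definition coord_char_poly (V : vectType F) n (e : n.-tuple V)
    (phi : sl2_rep V) : {mpoly F[4]} :=
  let mat x := map_mx (@mpolyC 4 F) (coord_mx e (phi x)) in
  \det (('X_0)%:M + 'X_1 *: mat (sl2_h F)
        + 'X_2 *: mat (sl2_e1 F) + 'X_3 *: mat (sl2_e2 F)).

Lemma sl2_char_poly_coord (V : vectType F) n (e : n.-tuple V) (phi : sl2_rep V) :
  basis_of {:V} e -> sl2_char_poly phi = coord_char_poly e phi.
Proof.
move=> eB; have dimE := vector.size_basis eB; case: n / dimE e eB => e eB.
transitivity (sl2_char_poly_in e phi).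
  by symmetry; apply: sl2_char_poly_basis.
by rewrite /sl2_char_poly_in /= !mxof_coord.
Qed.

Lemma sl2_rep_iso_char_poly (V W : vectType F)
    (phi : sl2_rep V) (psi : sl2_rep W) :
  sl2_rep_iso phi psi -> sl2_char_poly phi = sl2_char_poly psi.
Proof.
case=> T /[dup] Tbij /bij_inj /lker0P Tinj Tphi.
set e := vbasis {:V}; have eB : basis_of {:V} e := vbasisP _.
have imT : limg T = fullv.
  apply/eqP; rewrite eqEsubv subvf; apply/subvP=> w _.
  by have [T' _ T'K] := Tbij; rewrite -[w]T'K memv_img ?memvf.
have eB' : basis_of {:W} (map_tuple T e).
  by rewrite -imT limg_basis_of // (eqP Tinj) capv0.
rewrite (sl2_char_poly_coord phi eB) (sl2_char_poly_coord psi eB').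
rewrite /coord_char_poly.
suff E x : coord_mx (map_tuple T e) (psi x) = coord_mx e (phi x).
  by rewrite !E.
apply/matrixP=> i j; rewrite !mxE (nth_map 0) ?size_tuple //.
by rewrite -Tphi coord_map_basis.
Qed.

(** The substitution [z_0 = X, z_1 = -1, z_2 = z_3 = 0] turns
[det (z_0 + z_1 h + z_2 e_1 + z_3 e_2)] into [det (X - h)]. *)
Definition spec_h : {mpoly F[4]} -> {poly F} :=
  mmap (@polyC F) (fun i : 'I_4 => if i == 0 then 'X else if i == 1 then -1 else 0).

Lemma spec_h_char_poly (V : vectType F) n (e : n.-tuple V) (phi : sl2_rep V) :
  basis_of {:V} e ->
  spec_h (sl2_char_poly phi) = char_poly (coord_mx e (phi (sl2_h F))).
Proof.
move=> eB; rewrite (sl2_char_poly_coord phi eB) /coord_char_poly /spec_h.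
rewrite -det_map_mx /char_poly; congr (\det _); apply/matrixP=> i j; rewrite !mxE.
rewrite !rmorphD !rmorphM /= !rmorphMn /= !mmapC !mmapX !mmap1U /=.
by rewrite mulN1r !mul0r !addr0.
Qed.

Lemma char_poly_eigenbasis (V : vectType F) (I : finType) (b : I -> V)
    (a : I -> F) (g : 'End(V)) :
  free (codom b) -> (forall i, g (b i) = a i *: b i) ->
  char_poly (coord_mx (codom_tuple b) g) = \prod_(c <- codom a) ('X - c%:P).
Proof.
move=> fb gb.
have E i j : coord_mx (codom_tuple b) g i j = a (enum_val i) *+ (i == j).
  rewrite mxE (nth_image 0) gb linearZ /= -(nth_image 0 b i) (coord_free _ j fb).
  by case: (i == j); rewrite ?mulr1 ?mulr0.
rewrite char_poly_trig; last first.
  by apply/is_trig_mxP=> i j lt_ij; rewrite E -val_eqE ltn_eqF.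
rewrite big_image (reindex (@enum_val I predT)) /=; last exact/onW_bij/enum_val_bij.
by apply: eq_big => // i _; rewrite E eqxx.
Qed.

End Representation.

Lemma sl2_rep_triple (F : numFieldType) (V : vectType F) (phi : sl2_rep V) :
  sl2_triple (phi (sl2_e1 F)) (phi (sl2_e2 F)) (phi (sl2_h F)).
Proof.
split=> v.
- have := sl2_rep_bracket phi (sl2_h F) (sl2_e1 F).
  rewrite sl2_bracket_h_e1 linearZ /= => /(congr1 (fun g : 'End(V) => g v)).
  rewrite scale_lfunE add_lfunE opp_lfunE !comp_lfunE => ->.
  by rewrite addrCA subrr addr0.
- have := sl2_rep_bracket phi (sl2_h F) (sl2_e2 F).
  rewrite sl2_bracket_h_e2 linearN linearZ /= => /(congr1 (fun g : 'End(V) => g v)).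
  rewrite opp_lfunE scale_lfunE add_lfunE opp_lfunE !comp_lfunE => ->.
  by rewrite addrCA subrr addr0.
have := sl2_rep_bracket phi (sl2_e1 F) (sl2_e2 F).
rewrite sl2_bracket_e1_e2 => ->.
by rewrite add_lfunE opp_lfunE !comp_lfunE addrCA subrr addr0.
Qed.

Lemma sl2_rep_iso_of_char_poly (F : numFieldType) (V W : vectType F)
    (phi : sl2_rep V) (psi : sl2_rep W) :
  sl2_char_poly phi = sl2_char_poly psi -> sl2_rep_iso phi psi.
Proof.
have H := sl2_rep_triple phi; have H' := sl2_rep_triple psi.
have [ns [vs B]] := hwv_basis_exists H; have [ns' [ws B']] := hwv_basis_exists H'.
have wt_poly (U : vectType F) (rho : sl2_rep U) ms us :
    hwv_basis (rho (sl2_e1 F)) (rho (sl2_h F)) ms us ->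
    spec_h (sl2_char_poly rho) =
      \prod_(c <- codom (string_wt F (ns := ms))) ('X - c%:P).
  move=> Bu; have Hu := sl2_rep_triple rho; have [_ _ hus] := Bu.
  have sfree := string_vec_free Hu Bu; have sspan := string_vec_span Hu Bu.
  rewrite (@spec_h_char_poly _ _ _ (codom_tuple
    (string_vec (rho (sl2_e2 F)) us (ns := ms))) rho); last first.
    by rewrite /basis_of sfree sspan eqxx.
  apply: char_poly_eigenbasis => // p.
  exact: h_iter_f_hwv Hu (hus _).
move=> /(congr1 (@spec_h F)); rewrite (wt_poly _ _ _ _ B) (wt_poly _ _ _ _ B').
move=> /prod_XsubC_eq/string_wt_inj/(hwv_basis_perm B')[ws' B''].
have [T [Tbij Te Tf Th]] := hwv_basis_iso H H' B B''.
exists T => // x v; have [a [b [c ->]]] := sl2_span x.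
rewrite !linearD !linearZ !add_lfunE !scale_lfunE !linearD !linearZ /=.
by rewrite -!comp_lfunE Te Tf Th.
Qed.

Theorem theorem4p2 (R : realType) (V W : vectType R[i])
    (phi : sl2_rep V) (psi : sl2_rep W) :
  sl2_rep_iso phi psi <-> sl2_char_poly phi = sl2_char_poly psi.
Proof.
split; first exact: sl2_rep_iso_char_poly.
exact: sl2_rep_iso_of_char_poly.
Qed.
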